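(* Let $R$ be a commutative unital ring and let $\mathbb{A}$ be a left $s$-unital $R$-algebra. Then the category of left $s$-unital $\mathbb{A}$-modules is abelian.
   Context: An $R$-algebra $\mathbb{A}$ (not assumed unital) is a unital left $R$-module with an associative $R$-bilinear multiplication. A left $\mathbb{A}$-module is an abelian group $M$ with a unital left $R$-module structure and a biadditive action $\mathbb{A}\times M\to M$ such that $a.(b.m)=(ab).m$ and $r.(a.m)=(r.a).m=a.(r.m)$. Module homomorphisms are $R$-linear maps compatible with the action of $\mathbb{A}$. A left $\mathbb{A}$-module $M$ is $s$-unital if for every $m\in M$ there exists $e\in\mathbb{A}$ with $e.m=m$. The algebra $\mathbb{A}$ is left $s$-unital if it is $s$-unital as a left module over itself. The category of left $s$-unital modules is the full subcategory of the category of left $\mathbb{A}$-modules on the $s$-unital ones. *)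

(* Defs.v *)
From HB Require Import structures.
From mathcomp Require Import all_boot all_algebra.
From mathcomp Require Import boolp.

Set Implicit Arguments.
Unset Strict Implicit.
Unset Printing Implicit Defensive.

Import GRing.Theory.
Local Open Scope ring_scope.

Record category := Category {
  obj :> Type;
  hom : obj -> obj -> Type;
  idm : forall x, hom x x;
  comp : forall x y z, hom y z -> hom x y -> hom x z;
  comp1m : forall x y (f : hom x y), comp (idm y) f = f;
  compm1 : forall x y (f : hom x y), comp f (idm x) = f;
  compmA : forall x y z t (h : hom z t) (g : hom y z) (f : hom x y),
    comp h (comp g f) = comp (comp h g) f
}.

Arguments hom {c} x y.
Arguments idm {c} x.
Arguments comp {c x y z} g f.

Definition full_subcategory (C : category) (P : C -> Prop) : category :=
  @Category {x : C | P x}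
    (fun x y => hom (sval x) (sval y))
    (fun x => idm (sval x))
    (fun x y z g f => comp g f)
    (fun x y f => comp1m f)
    (fun x y f => compm1 f)
    (fun x y z t h g f => compmA h g f).

Definition is_mono (C : category) (x y : C) (f : hom x y) : Prop :=
  forall (w : C) (g h : hom w x), comp f g = comp f h -> g = h.

Definition is_epi (C : category) (x y : C) (f : hom x y) : Prop :=
  forall (z : C) (g h : hom y z), comp g f = comp h f -> g = h.

Definition is_zero_object (C : category) (z : C) : Prop :=
  forall x : C, (exists! f : hom z x, True) /\ (exists! f : hom x z, True).

Record preadditive (C : category) := Preadditive {
  zerom : forall x y : C, hom x y;
  addm : forall x y : C, hom x y -> hom x y -> hom x y;
  oppm : forall x y : C, hom x y -> hom x y;
  addmA : forall (x y : C) (f g h : hom x y),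
    addm f (addm g h) = addm (addm f g) h;
  addmC : forall (x y : C) (f g : hom x y), addm f g = addm g f;
  add0m : forall (x y : C) (f : hom x y), addm (zerom x y) f = f;
  addNm : forall (x y : C) (f : hom x y), addm (oppm f) f = zerom x y;
  comp_addml : forall (x y z : C) (g h : hom y z) (f : hom x y),
    comp (addm g h) f = addm (comp g f) (comp h f);
  comp_addmr : forall (x y z : C) (g : hom y z) (f h : hom x y),
    comp g (addm f h) = addm (comp g f) (comp g h)
}.

Arguments zerom {C} p x y.
Arguments addm {C} p {x y} f g.
Arguments oppm {C} p {x y} f.

Section Abelian.
Variables (C : category) (P : preadditive C).

Definition is_biproduct (x y b : C) (i1 : hom x b) (i2 : hom y b)
    (p1 : hom b x) (p2 : hom b y) : Prop :=
  [/\ comp p1 i1 = idm x, comp p2 i2 = idm y,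
      comp p1 i2 = zerom P y x, comp p2 i1 = zerom P x y &
      addm P (comp i1 p1) (comp i2 p2) = idm b].

Definition is_kernel (x y k : C) (f : hom x y) (i : hom k x) : Prop :=
  comp f i = zerom P k y /\
  forall (w : C) (h : hom w x), comp f h = zerom P w y ->
    exists! u : hom w k, comp i u = h.

Definition is_cokernel (x y q : C) (f : hom x y) (p : hom y q) : Prop :=
  comp p f = zerom P x q /\
  forall (w : C) (h : hom y w), comp h f = zerom P x w ->
    exists! u : hom q w, comp u p = h.

Record abelian_axioms : Prop := AbelianAxioms {
  has_zero_object : exists z : C, is_zero_object z;
  has_biproducts : forall x y : C,
    exists (b : C) (i1 : hom x b) (i2 : hom y b) (p1 : hom b x) (p2 : hom b y),
      is_biproduct i1 i2 p1 p2;
  has_kernels : forall (x y : C) (f : hom x y),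
    exists (k : C) (i : hom k x), is_kernel f i;
  has_cokernels : forall (x y : C) (f : hom x y),
    exists (q : C) (p : hom y q), is_cokernel f p;
  mono_is_kernel : forall (x y : C) (f : hom x y), is_mono f ->
    exists (z : C) (g : hom y z), is_kernel g f;
  epi_is_cokernel : forall (x y : C) (f : hom x y), is_epi f ->
    exists (z : C) (g : hom z x), is_cokernel g f
}.

End Abelian.

(* Being abelian is a property of the bare category: biproducts determine the
   addition of morphisms, so at most one preadditive structure qualifies. *)
Definition is_abelian (C : category) : Prop :=
  exists P : preadditive C, abelian_axioms P.

Record nuAlgebra (R : comPzRingType) := NuAlgebra {
  alg_lmod :> lmodType R;
  amul : alg_lmod -> alg_lmod -> alg_lmod;
  amulA : forall a b c, amul a (amul b c) = amul (amul a b) c;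
  amulDl : forall a b c, amul (a + b) c = amul a c + amul b c;
  amulDr : forall a b c, amul a (b + c) = amul a b + amul a c;
  amulZl : forall (r : R) a b, r *: amul a b = amul (r *: a) b;
  amulZr : forall (r : R) a b, r *: amul a b = amul a (r *: b)
}.

Arguments amul {R n} a b.

Record leftModule (R : comPzRingType) (A : nuAlgebra R) := LeftModule {
  mod_lmod :> lmodType R;
  act : A -> mod_lmod -> mod_lmod;
  actA : forall a b m, act a (act b m) = act (amul a b) m;
  actDl : forall a b m, act (a + b) m = act a m + act b m;
  actDr : forall a m n, act a (m + n) = act a m + act a n;
  actZl : forall (r : R) a m, r *: act a m = act (r *: a) m;
  actZr : forall (r : R) a m, r *: act a m = act a (r *: m)
}.

Arguments act {R A l} a m.

Definition regular_module (R : comPzRingType) (A : nuAlgebra R) :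
    leftModule A :=
  LeftModule (@amulA R A) (@amulDl R A) (@amulDr R A)
             (@amulZl R A) (@amulZr R A).

Definition s_unital (R : comPzRingType) (A : nuAlgebra R)
    (M : leftModule A) : Prop :=
  forall m : M, exists e : A, act e m = m.

Definition left_s_unital (R : comPzRingType) (A : nuAlgebra R) : Prop :=
  s_unital (regular_module A).

Record modHom (R : comPzRingType) (A : nuAlgebra R) (M N : leftModule A) :=
  ModHom {
    hom_lin :> {linear M -> N};
    hom_act : forall (a : A) (m : M), hom_lin (act a m) = act a (hom_lin m)
  }.

Lemma modHom_ext (R : comPzRingType) (A : nuAlgebra R) (M N : leftModule A)
  (f g : modHom M N) : f =1 g -> f = g.
Proof.
case: f g => [[f [[fD] [fZ]]] fA] [[g [[gD] [gZ]]] gA] /= /funext fg.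
case: _ / fg in gD gZ gA *.
by rewrite (Prop_irrelevance gD fD) (Prop_irrelevance gZ fZ) in gA *;
   rewrite (Prop_irrelevance gA fA).
Qed.

Section ModuleCategory.
Variables (R : comPzRingType) (A : nuAlgebra R).
Implicit Types M N P Q : leftModule A.

Definition modHom_id M : modHom M M :=
  @ModHom R A M M idfun (fun a m => erefl).

Lemma modHom_comp_act M N P (g : modHom N P) (f : modHom M N) (a : A) (m : M) :
  (g \o f) (act a m) = act a ((g \o f) m).
Proof. by rewrite /= !hom_act. Qed.

Definition modHom_comp M N P (g : modHom N P) (f : modHom M N) : modHom M P :=
  @ModHom R A M P (g \o f) (modHom_comp_act g f).

Lemma modHom_comp1m M N (f : modHom M N) : modHom_comp (modHom_id N) f = f.
Proof. exact: modHom_ext. Qed.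

Lemma modHom_compm1 M N (f : modHom M N) : modHom_comp f (modHom_id M) = f.
Proof. exact: modHom_ext. Qed.

Lemma modHom_compA M N P Q (h : modHom P Q) (g : modHom N P) (f : modHom M N) :
  modHom_comp h (modHom_comp g f) = modHom_comp (modHom_comp h g) f.
Proof. exact: modHom_ext. Qed.

Definition leftModule_category : category :=
  Category modHom_comp1m modHom_compm1 modHom_compA.

Definition s_unital_category : category :=
  @full_subcategory leftModule_category (@s_unital R A).

End ModuleCategory.

(* Main.v *)
(** The point is that s-unital modules are closed under submodules, quotients
    and finite direct sums in the abelian category of all left modules; kernels,
    cokernels and biproducts are then computed as for modules. Only sums need
    an argument (Tominaga's trick): if [e m = m] and [e'] fixes [n - e n], then
    [e + e' - e' e] fixes both [m] and [n]. *)

Require Import Defs.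
From HB Require Import structures.
From mathcomp Require Import all_boot all_algebra.
From mathcomp Require Import boolp.

Set Implicit Arguments.
Unset Strict Implicit.
Unset Printing Implicit Defensive.

Import GRing.Theory.
Local Open Scope ring_scope.
Local Open Scope quotient_scope.

(** * Compatibility of the action with negation and subtraction *)

Section Act.
Variables (R : comPzRingType) (A : nuAlgebra R) (M : leftModule A).

Lemma act_is_zmod_morphism (a : A) : zmod_morphism (@act R A M a).
Proof.
move=> m n; rewrite actDr; congr (_ + _).
by rewrite -scaleN1r -actZr scaleN1r.
Qed.

HB.instance Definition _ (a : A) :=
  GRing.isZmodMorphism.Build M M (act a) (act_is_zmod_morphism a).

Lemma act0r (a : A) : act a (0 : M) = 0. Proof. exact: raddf0. Qed.

Lemma actNr (a : A) (m : M) : act a (- m) = - act a m.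
Proof. exact: raddfN. Qed.

Lemma actBr (a : A) (m n : M) : act a (m - n) = act a m - act a n.
Proof. exact: raddfB. Qed.

Lemma actNl (a : A) (m : M) : act (- a) m = - act a m.
Proof. by rewrite -scaleN1r -actZl scaleN1r. Qed.

End Act.

(** * Submodules carried by a stable subspace *)

Section Submodule.
Variables (R : comPzRingType) (A : nuAlgebra R) (M : leftModule A).
Variables (S : submodClosed M) (S_act : forall a m, m \in S -> act a m \in S).

Definition submodule_sort := {m : M | m \in S}.

HB.instance Definition _ := SubChoice.on submodule_sort.
HB.instance Definition _ := [SubChoice_isSubLmodule of submodule_sort by <:].

Definition submodule_act (a : A) (m : submodule_sort) : submodule_sort :=
  exist _ (act a (val m)) (S_act a (valP m)).

Definition submodule : leftModule A.
Proof.
apply: (@LeftModule R A submodule_sort submodule_act).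
- by move=> a b m; apply: val_inj; rewrite /= actA.
- by move=> a b m; apply: val_inj; rewrite /= actDl.
- by move=> a m n; apply: val_inj; rewrite /= actDr.
- by move=> r a m; apply: val_inj; rewrite !linearZ /= actZl.
- by move=> r a m; apply: val_inj; rewrite !linearZ /= actZr.
Defined.

Definition submodule_incl : modHom submodule M :=
  @ModHom R A submodule M (val : submodule_sort -> M) (fun a m => erefl).

Lemma submodule_s_unital : s_unital M -> s_unital submodule.
Proof.
by move=> sM m; have [e em] := sM (val m); exists e; apply: val_inj.
Qed.

End Submodule.

(** * Quotients by a stable subspace *)

Section QuotientModule.
Variables (R : comPzRingType) (A : nuAlgebra R) (M : leftModule A).
Variables (S : submodClosed M) (S_act : forall a m, m \in S -> act a m \in S).

(** Keeps only the additive closure of [S], which is what the quotient group is formed from; scalars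
    and the action of [A] are put on that group below. *)
Definition submod_zmodClosed : zmodClosed M :=
  HB.pack (GRing.SubmodClosed.sort S)
    (GRing.isZmodClosed.Build M (GRing.SubmodClosed.sort S)
      (GRing.submod_closedB (submodClosedP S))).

Definition quotient_sort := {ideal_quot submod_zmodClosed}.

HB.instance Definition _ := GRing.Zmodule.on quotient_sort.

Local Notation pi := (\pi_({ideal_quot submod_zmodClosed}) : M -> quotient_sort).

Lemma quotient_eqP (m n : M) : reflect (pi m = pi n) (m - n \in S).
Proof.
have -> : (m - n \in S) = (m - n \in submod_zmodClosed) by [].
by rewrite Quotient.idealrBE; apply: eqP.
Qed.

(** Every class is [pi] of its representative. This reduces each module law on the quotient to
    classes [pi m], on which scaling and action are computed in [M]. *)
Lemma quotient_ind (P : quotient_sort -> Prop) :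
  (forall m, P (pi m)) -> forall q, P q.
Proof. by move=> Ppi q; rewrite -[q]reprK; apply: Ppi. Qed.

Lemma quotient_repr (m : M) : repr (pi m) - m \in S.
Proof. by apply/quotient_eqP; rewrite reprK. Qed.

Definition quotient_scale (r : R) (q : quotient_sort) : quotient_sort :=
  pi (r *: repr q).

(** Independence of the chosen representative: [repr (pi m) - m] lies in [S], and [S] is closed
    under scalars. *)
Lemma quotient_scaleE r m : quotient_scale r (pi m) = pi (r *: m).
Proof. by apply/quotient_eqP; rewrite -scalerBr rpredZ ?quotient_repr. Qed.

Lemma piD : {morph pi : m n / m + n}. Proof. exact: raddfD. Qed.

Lemma quotient_scaleA r s q :
  quotient_scale r (quotient_scale s q) = quotient_scale (r * s) q.
Proof.
by elim/quotient_ind: q => m; rewrite !quotient_scaleE scalerA.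
Qed.

Lemma quotient_scale1 : left_id 1 quotient_scale.
Proof. by elim/quotient_ind=> m; rewrite quotient_scaleE scale1r. Qed.

Lemma quotient_scaleDr : right_distributive quotient_scale +%R.
Proof.
move=> r; elim/quotient_ind=> m; elim/quotient_ind=> n.
by rewrite -piD !quotient_scaleE scalerDr piD.
Qed.

Lemma quotient_scaleDl q : {morph quotient_scale^~ q : r s / r + s}.
Proof.
by move=> r s; elim/quotient_ind: q => m; rewrite !quotient_scaleE scalerDl piD.
Qed.

HB.instance Definition _ := GRing.Zmodule_isLmodule.Build R quotient_sort
  quotient_scaleA quotient_scale1 quotient_scaleDr quotient_scaleDl.

Definition quotient_act (a : A) (q : quotient_sort) : quotient_sort :=
  pi (act a (repr q)).

(** Well-definedness again, now from the stability [S_act] of [S] under the action. *)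
Lemma quotient_actE a m : quotient_act a (pi m) = pi (act a m).
Proof. by apply/quotient_eqP; rewrite -actBr S_act ?quotient_repr. Qed.

Definition quotient_module : leftModule A.
Proof.
apply: (@LeftModule R A quotient_sort quotient_act).
- by move=> a b; elim/quotient_ind=> m; rewrite !quotient_actE actA.
- by move=> a b; elim/quotient_ind=> m; rewrite !quotient_actE actDl piD.
- move=> a; elim/quotient_ind=> m; elim/quotient_ind=> n.
  by rewrite -piD !quotient_actE actDr piD.
- move=> r a; elim/quotient_ind=> m.
  by rewrite !quotient_actE [LHS]quotient_scaleE actZl.
- move=> r a; elim/quotient_ind=> m.
  rewrite [r *: pi m]quotient_scaleE !quotient_actE.
  by rewrite [LHS]quotient_scaleE actZr.
Defined.

Lemma pi_is_semilinear : semilinear pi.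
Proof. by split=> [r m|]; [rewrite [RHS]quotient_scaleE | exact: piD]. Qed.

HB.instance Definition _ :=
  GRing.isSemilinear.Build R M quotient_sort _ pi pi_is_semilinear.

Definition quotient_proj : modHom M quotient_module :=
  @ModHom R A M quotient_module pi (fun a m => esym (quotient_actE a m)).

Lemma quotient_proj_surj (q : quotient_module) : exists m, quotient_proj m = q.
Proof. by elim/quotient_ind: q => m; exists m. Qed.

Lemma quotient_proj_eq0 (m : M) : quotient_proj m = 0 <-> m \in S.
Proof.
rewrite -(raddf0 quotient_proj) -{2}[m]subr0.
by split=> /quotient_eqP.
Qed.

Lemma quotient_s_unital : s_unital M -> s_unital quotient_module.
Proof.
move=> sM; elim/quotient_ind=> m; have [e em] := sM m.
by exists e; rewrite [LHS]quotient_actE em.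
Qed.

End QuotientModule.

(** * Kernels, images and cokernels of module homomorphisms *)

Section KernelImage.
Variables (R : comPzRingType) (A : nuAlgebra R) (M N : leftModule A).
Variable f : modHom M N.

Definition ker_pred : {pred M} := fun m => f m == 0.

Lemma ker_predP m : reflect (f m = 0) (m \in ker_pred).
Proof. exact: eqP. Qed.

Lemma ker_submod_closed : submod_closed ker_pred.
Proof.
split=> [|r m n /ker_predP fm /ker_predP fn]; apply/ker_predP.
  exact: raddf0.
by rewrite linearP fm fn scaler0 addr0.
Qed.

HB.instance Definition _ :=
  GRing.isSubmodClosed.Build R M ker_pred ker_submod_closed.

Lemma ker_act a m : m \in ker_pred -> act a m \in ker_pred.
Proof. by move=> /ker_predP fm; apply/ker_predP; rewrite hom_act fm act0r. Qed.

(** Closed predicates are boolean, so the existence of a preimage is decided classically. *)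
Definition im_pred : {pred N} := fun n => `[< exists m, f m = n >].

Lemma im_predP n : reflect (exists m, f m = n) (n \in im_pred).
Proof. exact: asboolP. Qed.

Lemma im_submod_closed : submod_closed im_pred.
Proof.
split=> [|r _ _ /im_predP[m <-] /im_predP[n <-]]; apply/im_predP.
  by exists 0; apply: raddf0.
by exists (r *: m + n); rewrite linearP.
Qed.

HB.instance Definition _ :=
  GRing.isSubmodClosed.Build R N im_pred im_submod_closed.

Lemma im_act a n : n \in im_pred -> act a n \in im_pred.
Proof.
by move=> /im_predP[m <-]; apply/im_predP; exists (act a m); rewrite hom_act.
Qed.

Definition kernel_module := submodule ker_act.
Definition kernel_incl : modHom kernel_module M := submodule_incl ker_act.
Definition cokernel_module := quotient_module im_act.
Definition cokernel_proj : modHom N cokernel_module := quotient_proj im_act.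

Lemma kernel_incl_inj : injective kernel_incl. Proof. exact: val_inj. Qed.

Lemma kernel_inclP m : f m = 0 <-> exists k, kernel_incl k = m.
Proof.
split=> [/ker_predP fm|[k <-]]; first by exists (exist _ m fm).
exact/ker_predP/(valP k).
Qed.

Lemma cokernel_proj_surj q : exists n, cokernel_proj n = q.
Proof. exact: quotient_proj_surj. Qed.

Lemma cokernel_projP n : cokernel_proj n = 0 <-> exists m, f m = n.
Proof. by rewrite quotient_proj_eq0; split=> /im_predP. Qed.

End KernelImage.

(** * Factoring through injections and surjections *)

Section Factorization.
Variables (R : comPzRingType) (A : nuAlgebra R) (W K M Q : leftModule A).

(** Choose a preimage under [i] of each [h w]. Linearity and equivariance of the choice can be
    tested after applying the injective [i], where they become those of [h]. *)
Lemma modHom_lift (i : modHom K M) (h : modHom W M) :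
    injective i -> (forall w, exists k, i k = h w) ->
  exists u : modHom W K, modHom_comp i u = h.
Proof.
move=> i_inj /choice[u iu].
have u_lin : semilinear u.
  by split=> [r v|v w]; apply: i_inj; rewrite ?linearZ ?raddfD /= !iu
    ?linearZ ?raddfD.
have u_act a w : u (act a w) = act a (u w).
  by apply: i_inj; rewrite hom_act !iu hom_act.
pose uL : {linear W -> K} :=
  HB.pack u (GRing.isSemilinear.Build R W K _ u u_lin).
by exists (@ModHom R A W K uL u_act); apply: modHom_ext => w; apply: iu.
Qed.

(** The factor is [h] composed with a set-theoretic section [s] of [p]. Once [u (p m) = h m] is
    known, linearity and equivariance follow by writing each [q] as [p (s q)]. *)
Lemma modHom_descend (p : modHom M Q) (h : modHom M W) :
    (forall q, exists m, p m = q) -> (forall m, p m = 0 -> h m = 0) ->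
  exists u : modHom Q W, modHom_comp u p = h.
Proof.
move=> p_surj hp0; have [s sK] := choice p_surj.
pose u q := h (s q).
have uE m : u (p m) = h m.
  (* [s (p m)] and [m] differ by an element of the kernel of [p], which [h] kills. *)
  apply/eqP; rewrite -subr_eq0 /u -raddfB; apply/eqP/hp0.
  by rewrite raddfB /= sK subrr.
have u_lin : semilinear u.
  split=> [r q|q q']; rewrite -[q]sK; first by rewrite -linearZ !uE linearZ.
  by rewrite -[q']sK -raddfD !uE raddfD.
have u_act a q : u (act a q) = act a (u q).
  by rewrite -[q]sK -hom_act !uE hom_act.
pose uL : {linear Q -> W} :=
  HB.pack u (GRing.isSemilinear.Build R Q W _ u u_lin).
by exists (@ModHom R A Q W uL u_act); apply: modHom_ext => m; apply: uE.
Qed.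

End Factorization.

Lemma modHom_eq1 (R : comPzRingType) (A : nuAlgebra R) (M N : leftModule A)
  (f g : modHom M N) : f = g -> f =1 g.
Proof. by move->. Qed.

(** * The additive group of homomorphisms *)

Section HomGroup.
Variables (R : comPzRingType) (A : nuAlgebra R) (M N : leftModule A).

Definition modHom_zero : modHom M N :=
  @ModHom R A M N \0 (fun a m => esym (act0r N a)).

Lemma modHom_add_act (f g : modHom M N) a m :
  (f \+ g) (act a m) = act a ((f \+ g) m).
Proof. by rewrite /= !hom_act actDr. Qed.

Definition modHom_add (f g : modHom M N) : modHom M N :=
  @ModHom R A M N (f \+ g) (modHom_add_act f g).

Lemma modHom_opp_act (f : modHom M N) a m :
  (\- f) (act a m) = act a ((\- f) m).
Proof. by rewrite /= hom_act actNr. Qed.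

Definition modHom_opp (f : modHom M N) : modHom M N :=
  @ModHom R A M N (\- f) (modHom_opp_act f).

End HomGroup.

(** * Binary direct sums *)

Section DirectSum.
Variables (R : comPzRingType) (A : nuAlgebra R) (M N : leftModule A).

Definition direct_sum : leftModule A.
Proof.
apply: (@LeftModule R A (M * N)%type (fun a m => (act a m.1, act a m.2))).
- by move=> a b m; rewrite /= !actA.
- by move=> a b m; rewrite /= !actDl.
- by move=> a m n; rewrite /= !actDr.
- by move=> r a m; congr pair; rewrite /= actZl.
- by move=> r a m; congr pair; rewrite /= actZr.
Defined.

Definition pair_inl (m : M) : direct_sum := (m, 0).
Definition pair_inr (n : N) : direct_sum := (0, n).

Lemma pair_inl_is_semilinear : semilinear pair_inl.
Proof. by split=> [r m|m n]; congr pair; rewrite /= ?scaler0 ?addr0. Qed.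

Lemma pair_inr_is_semilinear : semilinear pair_inr.
Proof. by split=> [r m|m n]; congr pair; rewrite /= ?scaler0 ?addr0. Qed.

HB.instance Definition _ := GRing.isSemilinear.Build R M direct_sum _
  pair_inl pair_inl_is_semilinear.
HB.instance Definition _ := GRing.isSemilinear.Build R N direct_sum _
  pair_inr pair_inr_is_semilinear.

Lemma pair_inl_act a m : pair_inl (act a m) = act a (pair_inl m).
Proof. by congr pair; rewrite /= act0r. Qed.

Lemma pair_inr_act a n : pair_inr (act a n) = act a (pair_inr n).
Proof. by congr pair; rewrite /= act0r. Qed.

Definition sum_inl : modHom M direct_sum :=
  @ModHom R A M direct_sum pair_inl pair_inl_act.
Definition sum_inr : modHom N direct_sum :=
  @ModHom R A N direct_sum pair_inr pair_inr_act.
Definition sum_fst : modHom direct_sum M :=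
  @ModHom R A direct_sum M (fst : M * N -> M) (fun a m => erefl).
Definition sum_snd : modHom direct_sum N :=
  @ModHom R A direct_sum N (snd : M * N -> N) (fun a m => erefl).

Lemma direct_sum_s_unital : s_unital M -> s_unital N -> s_unital direct_sum.
Proof.
move=> sM sN [m n]; have [e em] := sM m; have [e' e'n] := sN (n - act e n).
(* Formally this is [1 - (1 - e') (1 - e)]: the factor [1 - e] kills [m] and sends [n] to
   [n - act e n], which [1 - e'] kills. *)
exists (e + e' - amul e' e); congr pair.
  by rewrite /= !(actDl, actNl) -actA em addrK.
by rewrite /= !(actDl, actNl) -actA -addrA -actBr e'n addrC subrK.
Qed.

End DirectSum.

(** * The zero module *)

Section ZeroModule.
Variables (R : comPzRingType) (A : nuAlgebra R).

(** Row vectors of length 0 already carry an [R]-module structure; any two agree since there is no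
    column index. *)
Definition zero_module : leftModule A.
Proof.
by apply: (@LeftModule R A 'rV[R]_0 (fun _ _ => 0)) => *; apply/matrixP=> ? [].
Defined.

Lemma zero_module_eq0 (x : zero_module) : x = 0.
Proof. by apply/matrixP=> ? []. Qed.

Lemma zero_module_s_unital : s_unital zero_module.
Proof. by move=> x; exists 0; rewrite (zero_module_eq0 x). Qed.

End ZeroModule.

(** * The abelian structure on s-unital modules *)

Section SUnitalCategory.
Variables (R : comPzRingType) (A : nuAlgebra R).
Local Notation C := (s_unital_category A).
Implicit Types x y z : C.

Definition s_unital_preadditive : preadditive C.
Proof.
apply: (@Preadditive C (fun x y => modHom_zero (sval x) (sval y))
  (fun x y => @modHom_add R A _ _) (fun x y => @modHom_opp R A _ _));
  move=> *; apply: modHom_ext => m /=.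
- by rewrite addrA.
- by rewrite addrC.
- by rewrite add0r.
- by rewrite addNr.
- by [].
- by rewrite raddfD.
Defined.

Local Notation P := s_unital_preadditive.

(** A map killed by [f] takes values in the image of [i], hence lifts; injectivity gives uniqueness.
    Leaving [i] arbitrary lets the criterion serve both for kernel inclusions and for
    monomorphisms. *)
Lemma s_unital_is_kernel k x y (f : Defs.hom x y) (i : Defs.hom k x) :
    injective (i : modHom _ _) ->
    (forall m, (f : modHom _ _) m = 0 <-> exists n, (i : modHom _ _) n = m) ->
  is_kernel P f i.
Proof.
move=> i_inj ker_f; split=> [|w h fh].
  by apply: modHom_ext => n; apply/ker_f; exists n.
have [|u iu] := modHom_lift (h := h) i_inj.
  by move=> v; apply/ker_f; have /(congr1 (fun g : modHom _ _ => g v)) := fh.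
exists u; split=> // u' iu'; apply: modHom_ext => v; apply: i_inj.
exact: modHom_eq1 (etrans iu (esym iu')) v.
Qed.

(** Dually, a map that kills the image of [f] kills the kernel of [p], hence descends; surjectivity
    gives uniqueness. *)
Lemma s_unital_is_cokernel x y q (f : Defs.hom x y) (p : Defs.hom y q) :
    (forall n, exists m, (p : modHom _ _) m = n) ->
    (forall m, (p : modHom _ _) m = 0 <-> exists n, (f : modHom _ _) n = m) ->
  is_cokernel P f p.
Proof.
move=> p_surj ker_p; split=> [|w h hf].
  by apply: modHom_ext => n; apply/ker_p; exists n.
have [|u up] := modHom_descend (h := h) p_surj.
  move=> m /ker_p[n <-].
  exact: modHom_eq1 hf n.
exists u; split=> // u' up'; apply: modHom_ext => n; have [m <-] := p_surj n.
exact: modHom_eq1 (etrans up (esym up')) m.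
Qed.

Definition s_unital_kernel x y (f : Defs.hom x y) : C :=
  exist _ (kernel_module f) (submodule_s_unital (svalP x)).

Definition s_unital_cokernel x y (f : Defs.hom x y) : C :=
  exist _ (cokernel_module f) (quotient_s_unital (svalP y)).

(** Being mono is tested against s-unital modules only, but the module kernel is one of them. Its
    inclusion and the zero map agree after composition with [f], so the inclusion vanishes. *)
Lemma s_unital_mono_inj x y (f : Defs.hom x y) :
  is_mono f -> injective (f : modHom _ _).
Proof.
move=> f_mono m n fmn; apply/eqP; rewrite -subr_eq0; apply/eqP.
have [|k <-] := (kernel_inclP f (m - n)).1; first by rewrite raddfB /= fmn subrr.
have fk0 : Defs.comp f (kernel_incl f : Defs.hom (s_unital_kernel f) x) =
    Defs.comp f (zerom P (s_unital_kernel f) x).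
  apply: modHom_ext => l; rewrite /= raddf0.
  by apply/kernel_inclP; exists l.
exact: modHom_eq1 (f_mono _ _ _ fk0) k.
Qed.

(** The cokernel projection and the zero map agree on the image of [f], so the projection vanishes
    and every [n] lies in that image. *)
Lemma s_unital_epi_surj x y (f : Defs.hom x y) :
  is_epi f -> forall n, exists m, (f : modHom _ _) m = n.
Proof.
move=> f_epi n; apply/cokernel_projP.
have pf0 : Defs.comp (cokernel_proj f : Defs.hom y (s_unital_cokernel f)) f =
    Defs.comp (zerom P y (s_unital_cokernel f)) f.
  by apply: modHom_ext => m; apply/cokernel_projP; exists m.
exact: modHom_eq1 (f_epi _ _ _ pf0) n.
Qed.

Lemma s_unital_abelian : abelian_axioms P.
Proof.
split.
- exists (exist _ (zero_module A) (@zero_module_s_unital R A)) => x.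
  split; exists (modHom_zero _ _); split=> // g _; apply: modHom_ext => m.
    by rewrite (zero_module_eq0 m) !raddf0.
  by rewrite [RHS]zero_module_eq0.
- move=> x y.
  exists (exist _ _ (direct_sum_s_unital (svalP x) (svalP y))).
  exists (sum_inl _ _), (sum_inr _ _), (sum_fst _ _), (sum_snd _ _).
  (* The four identities on the summands hold by computation; only the decomposition of [(m, n)] as
     [(m, 0) + (0, n)] remains. *)
  split; apply: modHom_ext => // -[m n].
  by congr pair; rewrite /= ?addr0 ?add0r.
- move=> x y f; exists (s_unital_kernel f), (kernel_incl f).
  by apply: s_unital_is_kernel; [exact: kernel_incl_inj | exact: kernel_inclP].
- move=> x y f; exists (s_unital_cokernel f), (cokernel_proj f).
  apply: s_unital_is_cokernel; first exact: cokernel_proj_surj.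
  exact: cokernel_projP.
(* A mono is the kernel of its cokernel projection, whose zeros are exactly the image of [f]. *)
- move=> x y f f_mono; exists (s_unital_cokernel f), (cokernel_proj f).
  apply: s_unital_is_kernel; first exact: s_unital_mono_inj.
  exact: cokernel_projP.
(* An epi is the cokernel of its kernel inclusion. *)
- move=> x y f f_epi; exists (s_unital_kernel f), (kernel_incl f).
  apply: s_unital_is_cokernel; last exact: kernel_inclP.
  exact: s_unital_epi_surj.
Qed.

End SUnitalCategory.

Theorem corollary11 (R : comPzRingType) (A : nuAlgebra R)
  (sA : left_s_unital A) : is_abelian (s_unital_category A).
Proof. by exists (s_unital_preadditive A); apply: s_unital_abelian. Qed.
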